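(* For every positive integer $n$, $$\sum_{k=0}^{n}B^{*}_{n-k}(y,t)B^{*}_k(y,t)=\frac{1}{2(9y^2-t)}\left((n+1)C_n(y,t)-B^{*}_{n+1}(y,t)\right),$$ $$\sum_{k=0}^{n}2C_{n-k}(y,t)C_k(y,t)=(n+1)C_n(y,t)+B^{*}_{n+1}(y,t),$$ $$\sum_{k=0}^{n}2B^{*}_{n-k}(y,t)C_k(y,t)=(n+1)B^{*}_n(y,t).$$
   Context: Here $y,t$ are commuting variables (indeterminates). The bivariate balancing polynomials are defined by $B^{*}_0(y,t)=0$, $B^{*}_1(y,t)=1$, $B^{*}_n(y,t)=6yB^{*}_{n-1}(y,t)-tB^{*}_{n-2}(y,t)$ for $n\ge 2$; the bivariate Lucas-balancing polynomials by $C_0(y,t)=1$, $C_1(y,t)=3y$, $C_n(y,t)=6yC_{n-1}(y,t)-tC_{n-2}(y,t)$ for $n\ge 2$. *)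

(* Defs.v *)
From HB Require Import structures.
From mathcomp Require Import all_boot all_order all_algebra.
From mathcomp Require Import mpoly.

Set Implicit Arguments.
Unset Strict Implicit.
Unset Printing Implicit Defensive.

Import GRing.Theory.
Local Open Scope ring_scope.

(* All coefficients are integers, so the universal home is Z[y, t]; the
   polynomials over any other commutative ring are its images. *)
Definition bivpoly := {mpoly int[2]}.

Definition y : bivpoly := 'X_(ord0).
Definition t : bivpoly := 'X_(ord_max).

Fixpoint balancing (n : nat) : bivpoly :=
  match n with
  | 0 => 0
  | 1 => 1
  | (m.+1 as n').+1 => 6%:R * y * balancing n' - t * balancing m
  end.

Fixpoint lucas_balancing (n : nat) : bivpoly :=
  match n with
  | 0 => 1
  | 1 => 3%:R * y
  | (m.+1 as n').+1 => 6%:R * y * lucas_balancing n' - t * lucas_balancing m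
  end.

(* The field of rational functions Q(y, t), where 1 / (2 (9 y^2 - t)) lives;
   9 y^2 - t is a nonzero polynomial, so this is a genuine inverse. *)
Definition bivfrac := {fraction bivpoly}.

(* Main.v *)
(** Put [D = 9 y^2 - t].  The sequences satisfy the addition formulas
    [C_(m+k) = C_m C_k + D B_m B_k] and [B_(m+k) = B_m C_k + C_m B_k], like
    [cosh] and [sinh].  Summing the second one over [m + k = n] gives the third
    identity, and summing the first one gives [S_C + D S_B = (n+1) C_n] for the
    convolution squares [S_C], [S_B] of [C] and [B].  On the other hand
    [S_C - D S_B] satisfies the homogeneous three-term recurrence, the boundary
    terms [C_(n+2) - 3 y C_(n+1) = D B_(n+1)] cancelling, so it equals
    [B_(n+1)]; the first two identities follow by adding and subtracting. *)
Require Import Defs.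
From HB Require Import structures.
From mathcomp Require Import all_boot all_order all_algebra.
From mathcomp Require Import mpoly.
From mathcomp Require Import ring.
Import GRing.Theory.
Local Open Scope ring_scope.

Definition conv (R : comNzRingType) (f g : nat -> R) (n : nat) : R :=
  \sum_(k < n.+1) f (n - k)%N * g k.

Lemma conv0 (R : comNzRingType) (f g : nat -> R) : conv R f g 0 = f 0%N * g 0%N.
Proof. by rewrite /conv big_ord_recr big_ord0 /= add0r. Qed.

Lemma conv1 (R : comNzRingType) (f g : nat -> R) :
  conv R f g 1 = f 1%N * g 0%N + f 0%N * g 1%N.
Proof. by rewrite /conv !big_ord_recr big_ord0 /= add0r. Qed.

Lemma convC (R : comNzRingType) (f g : nat -> R) (n : nat) :
  conv R f g n = conv R g f n.
Proof.
rewrite /conv (reindex_inj rev_ord_inj) /=; apply: eq_bigr => k _.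
by rewrite subSS subKn 1?mulrC // -ltnS.
Qed.

(** In generating series, [(1 - a X + b X^2) F = f 0 + (f 1 - a f 0) X]; multiplying by [G] leaves
    the last two terms as boundary terms. *)
Lemma convSS (R : comNzRingType) (a b : R) (f g : nat -> R) (n : nat) :
  (forall m, f m.+2 = a * f m.+1 - b * f m) ->
  conv R f g n.+2 = a * conv R f g n.+1 - b * conv R f g n
                    + (f 1%N - a * f 0%N) * g n.+1 + f 0%N * g n.+2.
Proof.
move=> rec_f; rewrite /conv 2!big_ord_recr [X in a * X]big_ord_recr /=.
rewrite !subnn subSn // subnn.
have -> : \sum_(i < n.+1) f (n.+2 - i)%N * g i =
    a * (\sum_(i < n.+1) f (n.+1 - i)%N * g i)
    - b * \sum_(i < n.+1) f (n - i)%N * g i.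
  rewrite !mulr_sumr -sumrB; apply: eq_bigr => i _.
  (* This bound makes [n.+2 - i] a true double successor, so the recurrence of [f] applies. *)
  have le_in : (i <= n)%N by rewrite -ltnS.
  by rewrite !subSn ?rec_f ?leqW //; ring.
by ring.
Qed.

Lemma rec2_eq (R : comNzRingType) (a b : R) (f g : nat -> R) :
  (forall n, f n.+2 = a * f n.+1 - b * f n) ->
  (forall n, g n.+2 = a * g n.+1 - b * g n) ->
  f 0%N = g 0%N -> f 1%N = g 1%N -> forall n, f n = g n.
Proof.
move=> rec_f rec_g fg0 fg1 n.
suff [] : f n = g n /\ f n.+1 = g n.+1 by [].
by elim: n => [|n [IH0 IH1]]; split; rewrite // rec_f rec_g IH0 IH1.
Qed.

Lemma balancingSS (n : nat) :
  balancing n.+2 = 6%:R * y * balancing n.+1 - t * balancing n.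
Proof. by []. Qed.

Lemma lucas_balancingSS (n : nat) :
  lucas_balancing n.+2
    = 6%:R * y * lucas_balancing n.+1 - t * lucas_balancing n.
Proof. by []. Qed.

Lemma balancing0 : balancing 0 = 0. Proof. by []. Qed.
Lemma balancing1 : balancing 1 = 1. Proof. by []. Qed.
Lemma lucas_balancing0 : lucas_balancing 0 = 1. Proof. by []. Qed.
Lemma lucas_balancing1 : lucas_balancing 1 = 3%:R * y. Proof. by []. Qed.

Definition initE :=
  (balancing0, balancing1, lucas_balancing0, lucas_balancing1).

(** The one-step case of the addition formula: both sides satisfy the same second-order recurrence
    and agree at 0 and 1. *)
Lemma balancingS (n : nat) :
  balancing n.+1 = 3%:R * y * balancing n + lucas_balancing n.
Proof.
apply: (rec2_eq _ (6%:R * y) t (fun n => balancing n.+1)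
  (fun n => 3%:R * y * balancing n + lucas_balancing n)) => [m|m||].
- exact: balancingSS.
- by rewrite balancingSS lucas_balancingSS; ring.
- by rewrite !initE; ring.
- by rewrite balancingSS !initE; ring.
Qed.

Lemma lucas_balancingS (n : nat) :
  lucas_balancing n.+1
    = 3%:R * y * lucas_balancing n + (9%:R * y ^+ 2 - t) * balancing n.
Proof.
apply: (rec2_eq _ (6%:R * y) t (fun n => lucas_balancing n.+1)
  (fun n => 3%:R * y * lucas_balancing n
            + (9%:R * y ^+ 2 - t) * balancing n)) => [m|m||].
- exact: lucas_balancingSS.
- by rewrite balancingSS lucas_balancingSS; ring.
- by rewrite !initE; ring.
- by rewrite lucas_balancingSS !initE; ring.
Qed.

(** The two formulas are proved jointly, since a unit step in [m] mixes [B] and [C]. *)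
Lemma balancing_addition (m k : nat) :
  balancing (m + k)
    = balancing m * lucas_balancing k + lucas_balancing m * balancing k
  /\ lucas_balancing (m + k)
    = lucas_balancing m * lucas_balancing k
      + (9%:R * y ^+ 2 - t) * (balancing m * balancing k).
Proof.
elim: m => [|m [IHB IHC]]; first by rewrite !initE; split; ring.
by rewrite addSn !balancingS !lucas_balancingS IHB IHC; split; ring.
Qed.

Lemma conv_balancing_lucas (n : nat) :
  2%:R * conv _ balancing lucas_balancing n = n.+1%:R * balancing n.
Proof.
(* One of the two copies is reversed, so that each pair of summands is the expansion of
   [B_((n-k)+k)]. *)
rewrite mulr2n mulrDl mul1r {2}convC /conv -big_split /=.
rewrite (eq_bigr (fun=> balancing n)) => [|k _].
  by rewrite sumr_const card_ord mulr_natl.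
by rewrite -(balancing_addition _ _).1 subnK // -ltnS.
Qed.

Lemma conv_square_add (n : nat) :
  conv _ lucas_balancing lucas_balancing n
    + (9%:R * y ^+ 2 - t) * conv _ balancing balancing n
  = n.+1%:R * lucas_balancing n.
Proof.
rewrite /conv mulr_sumr -big_split /=.
rewrite (eq_bigr (fun=> lucas_balancing n)) => [|k _].
  by rewrite sumr_const card_ord mulr_natl.
by rewrite -(balancing_addition _ _).2 subnK // -ltnS.
Qed.

Lemma conv_square_sub (n : nat) :
  conv _ lucas_balancing lucas_balancing n
    - (9%:R * y ^+ 2 - t) * conv _ balancing balancing n
  = balancing n.+1.
Proof.
apply: (rec2_eq _ (6%:R * y) t
  (fun n => conv _ lucas_balancing lucas_balancing n
            - (9%:R * y ^+ 2 - t) * conv _ balancing balancing n)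
  (fun n => balancing n.+1)) => [m|m||].
- rewrite (convSS _ _ _ _ _ _ balancingSS) (convSS _ _ _ _ _ _ lucas_balancingSS).
  (* Only [C_(m+2)] in the boundary term needs expanding; the rest is linear. *)
  by rewrite (lucas_balancingS m.+1) !initE; ring.
- exact: balancingSS.
- by rewrite !conv0 !initE; ring.
- by rewrite !conv1 balancingSS !initE; ring.
Qed.

Lemma discriminant_neq0 : 2%:R * (9%:R * y ^+ 2 - t) != 0.
Proof.
(* Evaluate at [y = 1], [t = 0]. *)
pose v (i : 'I_2) : int := if i == ord0 then 1 else 0.
apply/eqP => /(congr1 (meval v)) /eqP.
rewrite !(rmorphM, rmorphB, rmorphXn, rmorph_nat, rmorph0) /=.
by rewrite /y /t !mevalXU.
Qed.

(** Reduces the first identity, stated with a quotient, to an identity between polynomials. *)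
Lemma tofrac_mulKl (R : idomainType) (d x : R) :
  d != 0 -> tofrac x = 1 / tofrac d * tofrac (d * x).
Proof. by move=> d_neq0; rewrite tofracM div1r mulKf // tofrac_eq0. Qed.

Theorem corollary4 (n : nat) (n_gt0 : (0 < n)%N) :
  [/\ tofrac (\sum_(k < n.+1) balancing (n - k) * balancing k)
        = 1 / tofrac (2%:R * (9%:R * y ^+ 2 - t))
          * tofrac (n.+1%:R * lucas_balancing n - balancing n.+1)
        :> bivfrac,
      \sum_(k < n.+1) 2%:R * lucas_balancing (n - k) * lucas_balancing k
        = n.+1%:R * lucas_balancing n + balancing n.+1
    & \sum_(k < n.+1) 2%:R * balancing (n - k) * lucas_balancing k
        = n.+1%:R * balancing n].
Proof.
split.
(* The numerator becomes [(S_C + D S_B) - (S_C - D S_B) = 2 D S_B]. *)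
- rewrite -conv_square_add -conv_square_sub -/(conv _ balancing balancing n).
  rewrite [LHS](tofrac_mulKl _ _ _ discriminant_neq0).
  by congr (_ * tofrac _); ring.
- rewrite -conv_square_add -conv_square_sub.
  under eq_bigr do rewrite -mulrA.
  by rewrite -mulr_sumr -/(conv _ lucas_balancing lucas_balancing n); ring.
- under eq_bigr do rewrite -mulrA.
  by rewrite -mulr_sumr -conv_balancing_lucas.
Qed.
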